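(* Let $t$ and $c$ be positive integers. Let $(G,\tau,\Sigma,\alpha)$ be a feasible connected instance of the $t$-Dimensional Even-Cut Problem and let $k$ be its optimal value. If the revised Random Contraction Algorithm (described below) is run independently $c|V(G)|^4$ times on $(G,\tau,\Sigma,\alpha)$, the probability that none of the runs returns a cocycle of $M(G,\tau,\Sigma,\alpha)$ of size $k$ is at most $e^{-24c}$.
   Context: The $t$-Dimensional Even-Cut Problem: an instance is $(G,\tau,\Sigma,\alpha)$ with $G$ a graph, $\tau:V(G)\to\mathrm{GF}(2)^t$, $\Sigma\subseteq E(G)$, $\alpha\in\mathrm{GF}(2)^t$; the optimal value is the minimum size of a non-empty set $\delta_G(X)\triangle\Sigma'$ with $(\Sigma',\alpha')\in\{(\Sigma,\alpha),(\emptyset,0)\}$, $X\subseteq V(G)$, $\tau(X)=\alpha'$ (where $\tau(X)=\sum_{v\in X}\tau(v)$ and $\delta_G(X)$ is the set of edges with exactly one end in $X$). It is feasible if such a non-empty set exists, connected if $G$ is connected. Let $T=\{1,\ldots,t\}$ be disjoint from $E(G)$; the incidence matrix of the instance is the $\mathrm{GF}(2)$ matrix with columns $E(G)\cup T$, first row $(\sigma,\alpha)$ where $\sigma$ is the characteristic vector of $\Sigma$, and further rows indexed by $V(G)$ forming $(A(G)\ B)$ where $A(G)$ is the incidence matrix of $G$ and row $v$ of $B$ is $\tau(v)$. $M(G,\tau,\Sigma,\alpha)$ is $M(A)/T$ for this matrix $A$; its non-empty cocycles are exactly the non-empty sets $\delta_G(X)\triangle\Sigma'$ above, so $k$ is its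 cogirth. For a non-loop edge $e$ with ends $x,y$, $(G,\tau,\Sigma,\alpha)/e=(G/e,\tau',\Sigma',\alpha')$ where $G/e$ contracts $e$ to a new vertex $z$, $\tau'(z)=\tau(x)+\tau(y)$ and $\tau'(v)=\tau(v)$ otherwise; if $e\notin\Sigma$ then $\Sigma'=\Sigma$, $\alpha'=\alpha$, and if $e\in\Sigma$ then $\Sigma'=\Sigma\triangle\delta_G(x)$, $\alpha'=\alpha+\tau(x)$. Revised Random Contraction Algorithm: Step 1: if $|V(G)|\le 2^t+4$, find a minimum-cardinality non-empty cocycle $C$ of $M(G,\tau,\Sigma,\alpha)$ by exhaustive search and return $C$. Step 2: choose a non-loop edge $e$ of $G$ uniformly at random, replace the instance by $(G,\tau,\Sigma,\alpha)/e$, and repeat from Step 1. *)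

(* Defs.v *)
From HB Require Import structures.
From mathcomp Require Import all_boot all_order all_algebra.
From mathcomp Require Import reals.
From mathcomp Require Import zify.

Set Implicit Arguments.
Unset Strict Implicit.
Unset Printing Implicit Defensive.

Import Order.TTheory GRing.Theory Num.Theory.

Definition symdiff (T : finType) (A B : {set T}) : {set T} :=
  (A :\: B) :|: (B :\: A).

Record matroid (E : finType) := Matroid {
  rk :> {set E} -> nat;
  rk_card : forall X : {set E}, rk X <= #|X|;
  rk_mono : forall X Y : {set E}, X \subset Y -> rk X <= rk Y;
  rk_submod : forall X Y : {set E}, rk (X :|: Y) + rk (X :&: Y) <= rk X + rk Y }.

Lemma rk_setU_card (E : finType) (M : matroid E) (X Y : {set E}) :
  M (X :|: Y) <= M X + #|Y|.
Proof. by have := rk_submod M X Y; have := rk_card M Y; lia. Qed.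

Section LinearMatroid.
Variables (F : fieldType) (R C : finType) (A : R -> C -> F).
Implicit Types X Y : {set C}.

Definition matrix_column (c : C) : 'cV[F]_#|R| := \col_i A (enum_val i) c.

Definition column_span X : {vspace 'cV[F]_#|R|} :=
  (\sum_(c in X) <[matrix_column c]>)%VS.

Definition column_rank X : nat := \dim (column_span X).

Lemma column_spanS X Y : X \subset Y -> (column_span X <= column_span Y)%VS.
Proof.
move=> sXY; apply/subv_sumP => c cX.
exact: (sumv_sup c) (subsetP sXY c cX) (subvv _).
Qed.

Lemma column_rank_card X : column_rank X <= #|X|.
Proof.
rewrite -sum1_card; apply: leq_trans (dimv_leq_sum _ _ _) _.
by apply: leq_sum => c _; rewrite dim_vline leq_b1.
Qed.

Lemma column_rank_mono X Y : X \subset Y -> column_rank X <= column_rank Y.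
Proof. by move=> sXY; apply/dimvS/column_spanS. Qed.

Lemma column_rank_submod X Y :
  column_rank (X :|: Y) + column_rank (X :&: Y)
    <= column_rank X + column_rank Y.
Proof.
rewrite /column_rank -(dimv_sum_cap (column_span X)); apply: leq_add.
  apply: dimvS; apply/subv_sumP => c; rewrite inE => /orP[cX|cY].
    exact: subv_trans (sumv_sup c cX (subvv _)) (addvSl _ _).
  exact: subv_trans (sumv_sup c cY (subvv _)) (addvSr _ _).
by apply: dimvS; rewrite subv_cap !column_spanS ?subsetIl ?subsetIr.
Qed.

(* M(A), where the rows and columns of A are indexed by R and C. *)
Definition linear_matroid : matroid C :=
  Matroid column_rank_card column_rank_mono column_rank_submod.

End LinearMatroid.

(* The contraction M / T, for a matroid M on the disjoint union of E and T. *)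
Section Contraction.
Variables (E T : finType) (M : matroid (E + T)%type).
Implicit Types X Y : {set E}.

Let T' : {set E + T} := [set inr i | i : T].
Definition contract_rank X : nat := M ([set inl e | e in X] :|: T') - M T'.

Lemma contract_rank_card X : contract_rank X <= #|X|.
Proof.
rewrite /contract_rank leq_subLR setUC -(card_imset X (@inl_inj E T)).
exact: rk_setU_card.
Qed.

Lemma contract_rank_mono X Y : X \subset Y -> contract_rank X <= contract_rank Y.
Proof. by move=> sXY; rewrite leq_sub2r // rk_mono // setSU // imsetS. Qed.

Lemma contract_rank_submod X Y :
  contract_rank (X :|: Y) + contract_rank (X :&: Y)
    <= contract_rank X + contract_rank Y.
Proof.
rewrite /contract_rank.
have mono (Z : {set E}) : M T' <= M ([set inl e | e in Z] :|: T').
  by rewrite rk_mono // subsetUr.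
have := rk_submod M ([set inl e | e in X] :|: T') ([set inl e | e in Y] :|: T').
rewrite -setUUl -setUIl -imsetU -imsetI; last by move=> ? ? _ _ [].
have leq_arith r a b c d : r <= a -> r <= b -> r <= c -> r <= d ->
    d + c <= a + b -> d - r + (c - r) <= a - r + (b - r) by lia.
exact: leq_arith.
Qed.

Definition contract_matroid : matroid E :=
  Matroid contract_rank_card contract_rank_mono contract_rank_submod.

End Contraction.

Section Dual.
Variables (E : finType) (M : matroid E).
Implicit Types X Y C : {set E}.

Definition dual_rank X : nat := #|X| + M (~: X) - M setT.

Lemma dual_rank_le X : M setT <= #|X| + M (~: X).
Proof. by rewrite addnC -(setUCr X) setUC rk_setU_card. Qed.

Lemma dual_rank_card X : dual_rank X <= #|X|.
Proof. by rewrite leq_subLR addnC leq_add2r rk_mono // subsetT. Qed.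

Lemma dual_rank_mono X Y : X \subset Y -> dual_rank X <= dual_rank Y.
Proof.
move=> sXY; apply: leq_sub2r.
have -> : ~: X = ~: Y :|: (Y :\: X).
  apply/setP=> e; rewrite !inE; have := subsetP sXY e.
  by case: (e \in X) => [->|]; case: (e \in Y).
have := rk_setU_card M (~: Y) (Y :\: X).
by have := cardsID X Y; rewrite (setIidPr sXY); lia.
Qed.

Lemma dual_rank_submod X Y :
  dual_rank (X :|: Y) + dual_rank (X :&: Y) <= dual_rank X + dual_rank Y.
Proof.
have := rk_submod M (~: X) (~: Y); have := cardsUI X Y; rewrite /dual_rank.
rewrite -setCI -setCU.
move: (dual_rank_le X) (dual_rank_le Y).
by move: (dual_rank_le (X :|: Y)) (dual_rank_le (X :&: Y)); lia.
Qed.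

Definition dual_matroid : matroid E :=
  Matroid dual_rank_card dual_rank_mono dual_rank_submod.

Definition dependent X : bool := M X < #|X|.
Definition circuit C : bool := minset dependent C.

End Dual.

Definition cocircuit (E : finType) (M : matroid E) (C : {set E}) : bool :=
  circuit (dual_matroid M) C.

(* A cocycle of a binary matroid is a disjoint union of cocircuits. *)
Definition cocycle (E : finType) (M : matroid E) (C : {set E}) : bool :=
  [exists P : {set {set E}},
    partition P C && [forall D in P, cocircuit M D]].

Definition minimum_nonempty_cocycle (E : finType) (M : matroid E)
    (C : {set E}) : Prop :=
  [/\ cocycle M C, C != set0 &
      forall D, cocycle M D -> D != set0 -> #|C| <= #|D|].

(* Loops and parallel edges are allowed.  The order of the two ends of an edge
   carries no meaning. *)
Record graph := Graph {
  vertex : finType;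
  edge : finType;
  ends : edge -> vertex * vertex }.

Section GraphTheory.
Variable G : graph.

Definition cut (X : {set vertex G}) : {set edge G} :=
  [set e | ((ends e).1 \in X) (+) ((ends e).2 \in X)].

Definition adjacent : rel (vertex G) := fun u v =>
  [exists e : edge G, (ends e == (u, v)) || (ends e == (v, u))].

Definition connected_graph : Prop := forall u v : vertex G, connect adjacent u v.

Definition nonloop_edge : finType :=
  {e : edge G | (ends e).1 != (ends e).2}.

End GraphTheory.

Record instance (t : nat) := Instance {
  igraph :> graph;
  tau : vertex igraph -> 'rV['F_2]_t;
  Sigma : {set edge igraph};
  alpha : 'rV['F_2]_t }.

Section EvenCut.
Variables (t : nat) (I : instance t).

Definition tau_set (X : {set vertex I}) : 'rV['F_2]_t :=
  (\sum_(v in X) tau v)%R.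

Definition even_cut (C : {set edge I}) : Prop :=
  exists (S : {set edge I}) (a : 'rV['F_2]_t) (X : {set vertex I}),
    [/\ (S, a) = (Sigma I, alpha I) \/ (S, a) = (set0, 0%R),
        tau_set X = a & C = symdiff (cut X) S].

Definition feasible : Prop := exists C, even_cut C /\ C != set0.

Definition optimal_value (k : nat) : Prop :=
  (exists C, [/\ even_cut C, C != set0 & #|C| = k]) /\
  (forall C, even_cut C -> C != set0 -> k <= #|C|).

(* The row None is (sigma, alpha); the row Some v is row v of (A(G) B).  In
   A(G) the column of a loop is zero. *)
Definition incidence_matrix (r : option (vertex I)) (c : edge I + 'I_t) :
    'F_2 :=
  match r, c with
  | None, inl e => ((e \in Sigma I)%:R)%R
  | None, inr i => alpha I ord0 i
  | Some v, inl e => (((v == (ends e).1) (+) (v == (ends e).2))%:R)%R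
  | Some v, inr i => tau v ord0 i
  end.

Definition even_cut_matroid : matroid (edge I) :=
  contract_matroid (linear_matroid incidence_matrix).

(* In I/e the two ends of e become None, and every other vertex v becomes
   Some v. *)
Section ContractEdge.
Variable e : nonloop_edge I.

Let x : vertex I := (ends (val e)).1.
Let y : vertex I := (ends (val e)).2.

Definition contract_graph : graph :=
  @Graph (option {v : vertex I | (v != x) && (v != y)})
         {f : edge I | f != val e}
         (fun f => (insub (ends (val f)).1, insub (ends (val f)).2)).

Definition contract_tau (w : vertex contract_graph) : 'rV['F_2]_t :=
  if w is Some v then tau (val v) else (tau x + tau y)%R.

Definition contract_Sigma : {set edge I} :=
  if val e \in Sigma I then symdiff (Sigma I) (cut [set x]) else Sigma I.

Definition contract_alpha : 'rV['F_2]_t :=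
  (if val e \in Sigma I then alpha I + tau x else alpha I)%R.

(* contract_Sigma never contains e, so no element is lost below. *)
Definition contract_edge : instance t :=
  @Instance t contract_graph contract_tau
    [set f | val f \in contract_Sigma] contract_alpha.

End ContractEdge.

End EvenCut.

Section Distributions.
Variable R : realType.
Local Open Scope ring_scope.

Record fdist (A : finType) := FDist {
  pmf :> A -> R;
  pmf_ge0 : forall a, 0 <= pmf a;
  pmf_sum1 : \sum_a pmf a = 1 }.

Definition prob (A : finType) (p : fdist A) (S : {set A}) : R :=
  \sum_(a in S) p a.

Section Dirac.
Variables (A : finType) (a0 : A).

Definition dirac_pmf (a : A) : R := (a == a0)%:R.

Lemma dirac_pmf_ge0 a : 0 <= dirac_pmf a.
Proof. exact: ler0n. Qed.

Lemma dirac_pmf_sum1 : \sum_a dirac_pmf a = 1.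
Proof.
rewrite (bigD1 a0) //= /dirac_pmf eqxx big1 ?addr0 // => a.
by move/negPf->.
Qed.

Definition fdist_dirac : fdist A := FDist dirac_pmf_ge0 dirac_pmf_sum1.

End Dirac.

(* The element a0 only witnesses that A is nonempty. *)
Section Uniform.
Variables (A : finType) (a0 : A).

Definition uniform_pmf (_ : A) : R := #|A|%:R^-1.

Lemma uniform_pmf_ge0 a : 0 <= uniform_pmf a.
Proof. by rewrite invr_ge0 ler0n. Qed.

Lemma uniform_pmf_sum1 : \sum_a uniform_pmf a = 1.
Proof.
rewrite sumr_const -[LHS]mulr_natl mulfV // pnatr_eq0 -lt0n.
by apply/card_gt0P; exists a0.
Qed.

Definition fdist_uniform : fdist A := FDist uniform_pmf_ge0 uniform_pmf_sum1.

End Uniform.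

Section Bind.
Variables (A B : finType) (p : fdist A) (q : A -> fdist B).

Definition bind_pmf (b : B) : R := \sum_a p a * q a b.

Lemma bind_pmf_ge0 b : 0 <= bind_pmf b.
Proof. by apply: sumr_ge0 => a _; rewrite mulr_ge0 ?pmf_ge0. Qed.

Lemma bind_pmf_sum1 : \sum_b bind_pmf b = 1.
Proof.
rewrite exchange_big /= -[RHS](pmf_sum1 p); apply: eq_bigr => a _.
by rewrite -mulr_sumr pmf_sum1 mulr1.
Qed.

Definition fdist_bind : fdist B := FDist bind_pmf_ge0 bind_pmf_sum1.

End Bind.

Definition fdist_map (A B : finType) (f : A -> B) (p : fdist A) : fdist B :=
  fdist_bind p (fun a => fdist_dirac (f a)).

(* The joint distribution of N independent samples from p. *)
Section Iid.
Variables (N : nat) (A : finType) (p : fdist A).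

Definition iid_pmf (w : {ffun 'I_N -> A}) : R := \prod_i p (w i).

Lemma iid_pmf_ge0 w : 0 <= iid_pmf w.
Proof. by apply: prodr_ge0 => i _; apply: pmf_ge0. Qed.

Lemma iid_pmf_sum1 : \sum_w iid_pmf w = 1.
Proof.
rewrite /iid_pmf -(bigA_distr_bigA (fun (_ : 'I_N) a => p a)) /=.
by rewrite big1 // => i _; apply: pmf_sum1.
Qed.

Definition fdist_iid : fdist {ffun 'I_N -> A} := FDist iid_pmf_ge0 iid_pmf_sum1.

End Iid.

End Distributions.

Section Algorithm.
Variables (R : realType) (t : nat).

(* Which of the minimum non-empty cocycles is found is left open.  A contraction
   of a feasible instance may be infeasible, in which case there is nothing to
   return. *)
Definition exhaustive_search
    (search : forall I : instance t, option {set edge I}) : Prop :=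
  forall I : instance t,
    match search I with
    | Some C => minimum_nonempty_cocycle (even_cut_matroid I) C
    | None => forall C, cocycle (even_cut_matroid I) C -> C = set0
    end.

Variable search : forall I : instance t, option {set edge I}.

(* A set of edges of I/e, viewed as a set of edges of I. *)
Definition lift_result (I : instance t) (e : nonloop_edge I)
    (C : option {set edge (contract_edge e)}) : option {set edge I} :=
  omap (fun D : {set {f : edge I | f != val e}} => [set val f | f in D]) C.

(* One contraction removes one vertex, so #|vertex I| is enough fuel (see
   random_contractionE).  The case where G is too large for exhaustive search but has no
   non-loop edge cannot arise from a connected instance; nothing is returned
   then. *)
Fixpoint random_contraction_rec (n : nat) (I : instance t) :
    fdist R (option {set edge I}) :=
  if #|vertex I| <= 2 ^ t + 4 then fdist_dirac R (search I) else
  if n isn't n'.+1 then fdist_dirac R None else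
  if [pick e : nonloop_edge I] is Some e0 then
    fdist_bind (fdist_uniform R e0) (fun e =>
      fdist_map (@lift_result I e) (random_contraction_rec n' (contract_edge e)))
  else fdist_dirac R None.

Definition random_contraction (I : instance t) : fdist R (option {set edge I}) :=
  random_contraction_rec #|vertex I| I.

Lemma card_contract_edge (I : instance t) (e : nonloop_edge I) :
  #|vertex I| = #|vertex (contract_edge e)|.+1.
Proof.
rewrite /= card_option card_sig; set x := (ends _).1; set y := (ends _).2.
have ne : x != y by exact: (valP e).
rewrite -(cardC [pred v | (v != x) && (v != y)]) addnC -addn2 addnC; congr addn.
have -> : 2 = #|[set x; y]| by rewrite cards2 ne.
by apply: eq_card => v; rewrite !inE negb_and !negbK.
Qed.

Lemma random_contraction_rec_fuel n m (I : instance t) :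
    #|vertex I| <= n -> #|vertex I| <= m ->
  random_contraction_rec n I =1 random_contraction_rec m I.
Proof.
elim: n m I => [|n IHn] [|m] I //=; rewrite ?leqn0.
- by move=> /eqP -> _.
- by move=> _ /eqP ->.
move=> len lem C; case: ifP => // _; case: pickP => // e0 _.
apply: eq_bigr => e _; congr (_ * _)%R; apply: eq_bigr => D _.
rewrite (card_contract_edge e) !ltnS in len lem.
by congr (_ * _)%R; apply: (IHn m (contract_edge e)).
Qed.

Lemma random_contractionE (I : instance t) :
  random_contraction I =1
    if #|vertex I| <= 2 ^ t + 4 then fdist_dirac R (search I) else
    if [pick e : nonloop_edge I] is Some e0 then
      fdist_bind (fdist_uniform R e0) (fun e =>
        fdist_map (@lift_result I e) (random_contraction (contract_edge e)))
    else fdist_dirac R None.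
Proof.
rewrite /random_contraction => C; case def_n: #|vertex I| => [|n] /=; rewrite def_n // -def_n.
case: ifP => // _; case: pickP => // e0 _.
apply: eq_bigr => e _; congr (_ * _)%R; apply: eq_bigr => D _.
have en : #|vertex (contract_edge e)| = n.
  by apply: succn_inj; rewrite -(card_contract_edge e).
congr (_ * _)%R.
apply: (@random_contraction_rec_fuel n #|vertex (contract_edge e)|
         (contract_edge e)) => //.
by rewrite en.
Qed.

End Algorithm.

Definition returns_cocycle_of_size (t : nat) (I : instance t) (k : nat)
    (C : option {set edge I}) : bool :=
  if C is Some D then cocycle (even_cut_matroid I) D && (#|D| == k) else false.

(* Main.v *)
(* The cocycles of the matroid of an instance are its even cuts, so contracting
   an edge outside an optimal cut C keeps the optimal value k and keeps C optimal.
   Among vertices with the same tau at most one has degree below k / 2, since two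
   of them would bound an even cut of size below k.  Hence with N = |V| - 2^t and
   m non-loop edges, k N <= 4 m, and a random contraction misses C with
   probability at least 1 - 4 / N.  The product of these factors down to N = 5
   telescopes to 1 / binomial(N, 4) >= 24 / |V|^4, and (1 - p)^n <= exp(- n p). *)
Require Import Defs.
From mathcomp Require Import all_boot all_order all_algebra.
From mathcomp Require Import reals sequences exp.
From mathcomp Require Import zify.

Set Implicit Arguments.
Unset Strict Implicit.
Unset Printing Implicit Defensive.

(* The analysis library has its own [cut], which would shadow the cut of a graph. *)
Import Defs.
Import Order.TTheory GRing.Theory Num.Theory.

(** * Symmetric differences and sums over GF(2) *)

Section SymmetricDifference.
Variable T : finType.
Implicit Types A B : {set T}.

Lemma in_symdiff A B x : (x \in symdiff A B) = (x \in A) (+) (x \in B).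
Proof. by rewrite !inE; do 2!case: (_ \in _). Qed.

Lemma card_symdiff_le A B : #|symdiff A B| <= #|A| + #|B|.
Proof.
rewrite (leq_trans (leq_card_setU _ _)) // leq_add // subset_leq_card //;
exact: subsetDl.
Qed.

Lemma symdiff_subset A B :
  A \subset B -> symdiff B A = B :\: A.
Proof.
move=> sAB; apply/setP=> x; rewrite in_symdiff !inE.
by have := subsetP sAB x; case: (x \in A) (x \in B) => [] [] // /(_ isT).
Qed.

Lemma natr_addb_F2 (a b : bool) : ((a (+) b)%:R = a%:R + b%:R :> 'F_2)%R.
Proof. by apply/val_inj; case: a; case: b. Qed.

Lemma addrr_F2 (V : lmodType 'F_2) (v : V) : (v + v = 0)%R.
Proof.
have two0 : (1 + 1 = 0 :> 'F_2)%R by apply/val_inj.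
by rewrite -[v]scale1r -scalerDl two0 scale0r.
Qed.

Lemma F2_natr (x : 'F_2) : (x = (x != 0)%:R)%R.
Proof. by apply/val_inj; case: x => [[|[|]]]. Qed.

Lemma sum_mem_F2 (V : lmodType 'F_2) (f : T -> V) A :
  (\sum_(x in A) f x = \sum_x (x \in A)%:R *: f x)%R.
Proof.
by rewrite big_mkcond; apply: eq_bigr => x _; case: ifP; rewrite ?scale1r ?scale0r.
Qed.

Lemma sum_symdiff_F2 (V : lmodType 'F_2) (f : T -> V) A B :
  (\sum_(x in symdiff A B) f x = \sum_(x in A) f x + \sum_(x in B) f x)%R.
Proof.
rewrite !sum_mem_F2 -big_split; apply: eq_bigr => x _.
by rewrite in_symdiff natr_addb_F2 scalerDl.
Qed.

End SymmetricDifference.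

Lemma big_option (V : nmodType) (T : finType) (f : option T -> V) :
  (\sum_r f r = f None + \sum_v f (Some v))%R.
Proof.
rewrite (bigD1 None) //= (reindex_omap Some id) /=; last by case.
by congr (_ + _)%R; apply: eq_bigl => v; rewrite eqxx.
Qed.

(** * Column ranks through linear functionals *)

Section LinearFunctionals.
Variables (F : fieldType) (R C : finType) (A : R -> C -> F).
Local Open Scope ring_scope.
Implicit Types X Y : {set C}.

(** The rows of [W] are the transposed columns in [X], padded with zeros, so a column killed by the
    cokernel [K] lies in the span. Hence some column of [K] is nonzero on [c], and its entries are
    the coefficients [y]. *)
Lemma column_span_functional X (c : C) :
  matrix_column A c \notin column_span A X ->
  exists2 y : R -> F, (forall d, d \in X -> \sum_r y r * A r d = 0)
                    & \sum_r y r * A r c != 0.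
Proof.
pose W : 'M[F]_(#|C|, #|R|) :=
  \matrix_i (if enum_val i \in X then (matrix_column A (enum_val i))^T else 0).
pose K := cokermx W.
have pairE j d : ((matrix_column A d)^T *m K) 0 j
    = \sum_r K (enum_rank r) j * A r d.
  rewrite mxE (reindex (@enum_rank R)) /=; last first.
    by apply: onW_bij; exact: enum_rank_bij.
  by apply: eq_bigr => r _; rewrite !mxE enum_rankK mulrC.
move=> cX; have /rV0Pn[j] : (matrix_column A c)^T *m K != 0.
  rewrite -submxE; apply: contra cX => /submxP[D defc].
  rewrite -[matrix_column A c]trmxK defc mulmx_sum_row linear_sum /=.
  apply: memv_suml => i _; rewrite rowK linearZ /=; apply: memvZ.
  case: ifP => [iX|_]; last by rewrite linear0 mem0v.
  by rewrite trmxK; apply: (subvP (sumv_sup _ iX (subvv _))); rewrite memv_line.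
rewrite pairE => Kc; exists (fun r => K (enum_rank r) j) => // d dX.
rewrite -pairE.
suff -> : (matrix_column A d)^T *m K = 0 by rewrite mxE.
apply/eqP; rewrite -submxE.
by rewrite (_ : _^T = row (enum_rank d) W) ?row_sub // rowK enum_rankK dX.
Qed.

Lemma functional_column_span X (y : R -> F) (c : C) :
  (forall d, d \in X -> \sum_r y r * A r d = 0) -> \sum_r y r * A r c != 0 ->
  matrix_column A c \notin column_span A X.
Proof.
pose u : 'rV[F]_#|R| := \row_i y (enum_val i).
have uE d : (u *m matrix_column A d) 0 0 = \sum_r y r * A r d.
  rewrite mxE [RHS](reindex (@enum_val R predT)) /=; last first.
    exact/onW_bij/enum_val_bij.
  by apply: eq_bigr => i _; rewrite !mxE.
move=> y0; apply: contra => cX; rewrite -uE.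
suff : (column_span A X <= lker (linfun (mulmx u : 'cV_#|R| -> 'cV_1)))%VS.
  by move/subvP/(_ _ cX); rewrite memv_ker lfunE /= => /eqP ->; rewrite mxE.
apply/subv_sumP => d dX; rewrite -memvE memv_ker lfunE /=.
by apply/eqP/matrixP=> i j; rewrite !ord1 uE y0 // mxE.
Qed.

(** Turns a comparison of ranks into a combination of rows, which for the incidence matrix is a
    candidate even cut. *)
Lemma column_rank_ltP X Y : X \subset Y ->
  reflect (exists y : R -> F,
             (forall d, d \in X -> \sum_r y r * A r d = 0)
             /\ exists2 c, c \in Y & \sum_r y r * A r c != 0)
          (column_rank A X < column_rank A Y)%N.
Proof.
move=> sXY; have sV := column_spanS A sXY; rewrite /column_rank.
rewrite ltn_neqAle dimvS // andbT; apply: (iffP idP) => [neq|[y [y0 [c cY yc]]]].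
  have [c cY cX] : exists2 c, c \in Y & matrix_column A c \notin column_span A X.
    apply/exists_inP; apply: contraR neq => /exists_inPn XY.
    rewrite eqn_leq dimvS //= dimvS //; apply/subv_sumP => c cY.
    by rewrite -memvE; apply: contraNT (XY c cY).
  by have [y y0 yc] := column_span_functional cX; exists y; split=> //; exists c.
apply/negP=> /eqP eqd; have /negP[] := functional_column_span y0 yc.
have /eqP -> : column_span A X == column_span A Y by rewrite eqEdim sV eqd /=.
by apply: (subvP (sumv_sup _ cY (subvv _))); rewrite memv_line.
Qed.

End LinearFunctionals.

(** * Cocircuits, cocycles and even cuts *)

Section DualMatroid.
Variables (E : finType) (M : matroid E).

Lemma dependent_dual (X : {set E}) :
  dependent (dual_matroid M) X = (M (~: X) < M setT).
Proof.
rewrite /dependent /= /dual_rank.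
by have := dual_rank_le M X; have := rk_mono M (subsetT (~: X)); lia.
Qed.

End DualMatroid.

Section EvenCuts.
Variables (t : nat) (I : instance t).
Implicit Types (X : {set vertex I}) (C D : {set edge I}).

(** The pair [(s, X)] encodes a combination of rows of the incidence matrix: [s] is the coefficient
    of the first row and [X] the set of vertex rows used. The condition on [tau_set] says that the
    combination vanishes on the terminal columns. *)
Definition even_cut_by (s : bool) X C : Prop :=
  tau_set X = (s%:R *: alpha I)%R /\
  forall e, (e \in C) =
    [&& s & e \in Sigma I] (+) ((ends e).1 \in X) (+) ((ends e).2 \in X).

Lemma even_cutP C : even_cut C <-> exists s X, even_cut_by s X C.
Proof.
split=> [[S [a [X [Sa tauX ->]]]]|[s [X [tauX defC]]]].
  case: Sa tauX => [[-> ->]|[-> ->]] tauX; [exists true | exists false];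
    exists X; split; rewrite ?scale1r ?scale0r // => e;
    by rewrite in_symdiff !inE ?addbF // addbC addbA.
exists (if s then Sigma I else set0), (s%:R *: alpha I)%R, X; split=> //.
  by case: s {tauX defC}; [left; rewrite scale1r | right; rewrite scale0r].
apply/setP=> e; rewrite defC in_symdiff -addbA addbC !inE; congr (_ (+) _).
by case: (s); rewrite ?inE.
Qed.

Lemma even_cut0 : even_cut (set0 : {set edge I}).
Proof.
apply/even_cutP; exists false, set0; split=> [|e]; last by rewrite !inE.
by rewrite /tau_set big_set0 scale0r.
Qed.

Lemma tau_set_symdiff X Y : tau_set (symdiff X Y) = (tau_set X + tau_set Y)%R.
Proof. exact: sum_symdiff_F2. Qed.

Lemma even_cut_symdiff C D : even_cut C -> even_cut D -> even_cut (symdiff C D).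
Proof.
move=> /even_cutP[s1 [X [tauX defC]]] /even_cutP[s2 [Y [tauY defD]]].
apply/even_cutP; exists (s1 (+) s2), (symdiff X Y); split=> [|e].
  by rewrite tau_set_symdiff tauX tauY natr_addb_F2 scalerDl.
rewrite !in_symdiff defC defD.
move: (e \in Sigma I) (_.1 \in X) (_.2 \in X) (_.1 \in Y) (_.2 \in Y).
by case: (s1) (s2) => [] [] [] [] [] [] [].
Qed.

Definition row_coef (s : bool) X (r : option (vertex I)) : 'F_2 :=
  (if r is Some v then v \in X else s)%:R%R.

Lemma row_coef_edge s X e :
  (\sum_r row_coef s X r * incidence_matrix r (inl e) =
   ([&& s & e \in Sigma I] (+) ((ends e).1 \in X) (+) ((ends e).2 \in X))%:R)%R.
Proof.
have sum1 u : (\sum_v (v \in X)%:R * (v == u)%:R = (u \in X)%:R :> 'F_2)%R.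
  rewrite (bigD1 u) //= eqxx mulr1 big1 ?addr0 // => v /negPf ->.
  exact: mulr0.
rewrite big_option /= -natrM mulnb !natr_addb_F2 -addrA; congr (_ + _)%R.
by under eq_bigr => v _ do rewrite natr_addb_F2 mulrDr; rewrite big_split !sum1.
Qed.

Lemma row_coef_terminal s X i :
  (\sum_r row_coef s X r * incidence_matrix r (inr i) =
   (s%:R *: alpha I + tau_set X) ord0 i)%R.
Proof.
rewrite big_option /= !mxE; congr (_ + _)%R.
by rewrite summxE (sum_mem_F2 (fun v => tau v ord0 i : ('F_2)^o)).
Qed.

Lemma row_coef_surj (y : option (vertex I) -> 'F_2) :
  y =1 row_coef (y None != 0%R) [set v | y (Some v) != 0%R].
Proof. by case=> [v|]; rewrite [LHS]F2_natr /row_coef ?inE. Qed.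

(** Dependence in the dual means that the columns outside [C], together with [T], have smaller rank
    than all columns, so some combination of rows vanishes on them but not everywhere. Its support
    is the even cut [D]. *)
Lemma dependent_even_cut C :
  dependent (dual_matroid (even_cut_matroid I)) C <->
  exists D, [/\ even_cut D, D != set0 & D \subset C].
Proof.
pose T' : {set edge I + 'I_t} := [set inr i | i : 'I_t].
pose EC (Y : {set edge I}) := [set inl e | e in Y] :|: T'.
rewrite dependent_dual /= /contract_rank -/T' -!/(EC _).
set A := incidence_matrix (I := I).
(* Both ranks are at least that of [T'], so the truncated subtractions do not affect the
   comparison. *)
have -> : (column_rank A (EC (~: C)) - column_rank A T'
             < column_rank A (EC setT) - column_rank A T')
    = (column_rank A (EC (~: C)) < column_rank A (EC setT)).
  have := column_rank_mono A (subsetUr [set inl e | e in ~: C] T').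
  have := column_rank_mono A (subsetUr [set inl e | e in [set: edge I]] T').
  by rewrite -!/(EC _) /=; lia.
have sEC : EC (~: C) \subset EC setT by rewrite setSU // imsetS // subsetT.
have inlE (Y : {set edge I}) e : (inl e \in EC Y) = (e \in Y).
  rewrite inE mem_imset ?orbF //; last by move=> ? ? [].
  by apply/orb_idr => /imsetP[].
have inrE (Y : {set edge I}) i : inr i \in EC Y.
  by rewrite inE (imset_f inr) ?orbT.
split=> [/(column_rank_ltP A sEC)[y [y0 [c _ yc]]]
        |[D [/even_cutP[s [X [tauX defD]]] D0 sDC]]].
  pose s := y None != 0%R; pose X := [set v | y (Some v) != 0%R].
  have yE c' : (\sum_r y r * A r c' = \sum_r row_coef s X r * A r c')%R.
    by apply: eq_bigr => r _; rewrite [y r]row_coef_surj.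
  pose D := [set e | (\sum_r y r * A r (inl e) != 0)%R].
  exists D; split.
  - apply/even_cutP; exists s, X; split=> [|e].
      apply/rowP=> i; have := y0 (inr i) (inrE _ i).
      rewrite yE row_coef_terminal mxE => /eqP; rewrite addr_eq0 => /eqP ->.
      by apply/eqP; rewrite -addr_eq0 (addrr_F2 (_ : ('F_2)^o)).
    by rewrite inE yE row_coef_edge; case: (_ (+) _ (+) _).
  (* [y] vanishes on every terminal, so the column where it is nonzero is an edge. *)
  - case: c yc => [e|i]; last by rewrite y0 ?eqxx.
    by move=> ye; apply/set0Pn; exists e; rewrite inE.
  apply/subsetP=> e; rewrite inE; apply: contraR => eC.
  by rewrite y0 // inlE inE.
apply/(column_rank_ltP A sEC); exists (row_coef s X); split=> [[e|i] cC|].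
- rewrite inlE inE in cC; rewrite row_coef_edge -defD.
  by rewrite (contraNF (subsetP sDC e)).
- by rewrite row_coef_terminal tauX addrr_F2 mxE.
have [e eD] := set0Pn _ D0; exists (inl e); first by rewrite inlE inE.
by rewrite row_coef_edge -defD eD.
Qed.

Lemma cocircuit_even_cut C : cocircuit (even_cut_matroid I) C -> even_cut C.
Proof.
case/minsetP=> /dependent_even_cut[D [evD D0 sDC]] minC.
by rewrite -(minC D) //; apply/dependent_even_cut; exists D.
Qed.

Lemma even_cut_cocircuit C : even_cut C -> C != set0 ->
  exists2 D : {set edge I}, cocircuit (even_cut_matroid I) D & D \subset C.
Proof.
move=> evC C0; have depC : dependent (dual_matroid (even_cut_matroid I)) C.
  by apply/dependent_even_cut; exists C.
by have [D minD sDC] := minset_exists depC; exists D.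
Qed.

Lemma cocircuit_neq0 C : cocircuit (even_cut_matroid I) C -> C != set0.
Proof.
case/minsetP=> /dependent_even_cut[D [_ D0 sDC]] _.
by apply: contraNneq D0 => C0; rewrite -subset0 -C0.
Qed.

(** A union of disjoint even cuts is their symmetric difference, hence an even cut. Conversely,
    removing a cocircuit [D] from an even cut [C] containing it leaves [symdiff C D], a smaller even
    cut, and induction on [#|C|] gives the partition. *)
Lemma cocycleP C : reflect (even_cut C) (cocycle (even_cut_matroid I) C).
Proof.
apply: (iffP existsP) => [[P /andP[partP /forall_inP cocP]]|].
  rewrite -(cover_partition partP) /cover.
  have [_ trivP _] := and3P partP.
  (* Induction over the list of blocks: uniqueness makes the head differ from the later blocks, and
     [trivP] then makes it disjoint from them. *)
  have : {subset enum P <= P} /\ uniq (enum P).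
    by split=> [D|]; rewrite ?mem_enum ?enum_uniq.
  rewrite -big_enum /=; elim: (enum P) => [|D s IHs] [sP] //=.
    by rewrite big_nil => _; exact: even_cut0.
  case/andP=> Ds us; rewrite big_cons.
  have DP : D \in P by rewrite sP ?mem_head.
  have s'P : {subset s <= P} by move=> B Bs; rewrite sP // inE Bs orbT.
  have := even_cut_symdiff (cocircuit_even_cut (cocP _ DP)) (IHs (conj s'P us)).
  congr even_cut; apply/setP=> e; rewrite in_symdiff inE.
  case eD: (e \in D) => //=; rewrite (_ : (e \in _) = false) //.
  apply/negP; rewrite bigcup_seq => /bigcupP[B Bs eB].
  have /trivIsetP/(_ _ _ DP (s'P B Bs)) := trivP.
  have -> : D != B by apply: contraNneq Ds => ->.
  by move=> /(_ isT) /disjoint_setI0/setP/(_ e); rewrite !inE eD eB.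
have [n] := ubnP #|C|; elim: n C => // n IHn C ltCn evC.
have [->|C0] := eqVneq C set0.
  by exists set0; rewrite partition_set0 eqxx; apply/forall_inP=> D; rewrite inE.
have [D cocD sDC] := even_cut_cocircuit evC C0.
have D0 := cocircuit_neq0 cocD.
have [||P /andP[partP cocP]] := IHn (C :\: D).
- have := cardsID D C; rewrite (setIidPr sDC) => cardC.
  by move: D0 ltCn; rewrite -card_gt0; lia.
- by rewrite -symdiff_subset //; exact/even_cut_symdiff/cocircuit_even_cut.
exists (D |: P); apply/andP; split; last first.
  by apply/forall_inP=> B /setU1P[->//|]; exact: (forall_inP cocP).
rewrite -(setID C D) (setIidPr sDC) partitionU1 //.
by rewrite disjoint_sym disjoints_subset setDE subsetIr.
Qed.

Lemma minimum_nonempty_cocycle_size C k : optimal_value I k ->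
  minimum_nonempty_cocycle (even_cut_matroid I) C -> #|C| = k.
Proof.
case=> [[D [evD D0 cardD]] minD] [/cocycleP evC C0 minC].
apply/eqP; rewrite eqn_leq minD // andbT -cardD minC //; exact/cocycleP.
Qed.

End EvenCuts.

(** * Contraction of a non-loop edge *)

Section EdgeContraction.
Variables (t : nat) (I : instance t) (e : nonloop_edge I).
Implicit Types (X : {set vertex I}) (C : {set edge I}).

Local Notation x := (ends (val e)).1.
Local Notation y := (ends (val e)).2.
Local Notation J := (contract_edge e).
Local Notation lift D := [set val f | f in (D : {set edge J})].

(** The quotient map on vertices. The same [insub] gives the ends of edges in [contract_graph], so
    cuts pull back along it. *)
Definition merge (v : vertex I) : vertex J :=
  insub v : option {v : vertex I | (v != x) && (v != y)}.

Lemma merge_end1 : merge x = None.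
Proof. by rewrite /merge insubF // eqxx. Qed.

Lemma merge_end2 : merge y = None.
Proof. by rewrite /merge insubF // eqxx andbF. Qed.

Lemma merge_val (v : {v : vertex I | (v != x) && (v != y)}) :
  merge (val v) = Some v.
Proof. exact: valK. Qed.

Lemma merge_fiber v (w : vertex J) : (merge v == w) =
  (if w is Some u then v == val u else (v == x) || (v == y)).
Proof.
case: w => [u|]; rewrite /merge; case: insubP => [w w_in defv|].
- by rewrite -defv (inj_eq val_inj) /eq_op /= /eq_op.
- by move=> nv; apply/esym/negbTE; apply: contraNneq nv => ->; exact: (valP u).
- by rewrite -defv; apply/esym/negbTE; rewrite negb_or (valP w).
- by rewrite negb_and !negbK => ->.
Qed.

(** The sum splits over the fibres of [merge]. The fibre over [None] consists of the two distinct
    ends of [e], whose values add up to [contract_tau None]. *)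
Lemma tau_set_merge (X' : {set vertex J}) :
  tau_set [set v | merge v \in X'] = tau_set X'.
Proof.
rewrite /tau_set (partition_big merge (mem X')) /=; last by move=> v; rewrite inE.
apply: eq_bigr => w wX'.
rewrite (eq_bigl (fun v => merge v == w)); last first.
  by move=> v; rewrite inE andb_idl // => /eqP ->.
under eq_bigl => v do rewrite merge_fiber.
case: w wX' => [u|] _ /=; first by rewrite big_pred1_eq.
rewrite (bigD1 x) ?eqxx //= (bigD1 y) ?eqxx ?orbT //=; last by rewrite eq_sym (valP e).
rewrite big1 ?addr0 // => v /andP[/andP[]].
by case/orP=> /eqP ->; rewrite eqxx.
Qed.

(* Switching at [x] when it is needed makes the coefficient vector of [C]
   constant on the ends of [e]. *)
Definition switch (s : bool) X : {set vertex I} :=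
  symdiff X (if s && (val e \in Sigma I) then [set x] else set0).

Lemma in_switch s X v :
  (v \in switch s X) = (v \in X) (+) [&& s, val e \in Sigma I & v == x].
Proof.
by rewrite in_symdiff; case: s; case: (val e \in _); rewrite /= inE.
Qed.

Lemma tau_set_switch s X :
  (tau_set (switch s X) = s%:R *: alpha I <-> tau_set X = s%:R *: alpha J)%R.
Proof.
rewrite tau_set_symdiff /= /contract_alpha.
case: (val e \in _); last by rewrite andbF /tau_set big_set0 addr0.
case: s => /=; last by rewrite /tau_set big_set0 addr0 !scale0r.
rewrite !scale1r /tau_set big_set1; split=> [<-|->]; rewrite -addrA ?addrr_F2 addr0 //.
Qed.

Lemma in_contract_Sigma f : (f \in contract_Sigma e) =
  (f \in Sigma I)
    (+) ((val e \in Sigma I) && (((ends f).1 == x) (+) ((ends f).2 == x))).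
Proof.
rewrite /contract_Sigma; case: ifP => _; last by rewrite addbF.
by rewrite in_symdiff !inE.
Qed.

Lemma mem_lift (D : {set edge J}) (f : edge J) : (val f \in lift D) = (f \in D).
Proof. by rewrite mem_imset //; exact: val_inj. Qed.

Lemma mem_lift_contracted (D : {set edge J}) : val e \notin lift D.
Proof. by apply/imsetP=> -[f _ ef]; have := valP f; rewrite -ef eqxx. Qed.

Lemma card_lift (D : {set edge J}) : #|lift D| = #|D|.
Proof. by rewrite card_imset //; exact: val_inj. Qed.

(** The preimage of [X'] has both ends of [e] on one side; switching at [x] separates them exactly
    when the term of [e] from [Sigma] must be cancelled. On the other edges the switch undoes the
    change from [Sigma I] to [contract_Sigma]. *)
Lemma even_cut_lift (D : {set edge J}) : even_cut D -> even_cut (lift D).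
Proof.
move/even_cutP=> [s [X' [tauX' defD]]]; apply/even_cutP.
exists s, (switch s [set v | merge v \in X']); split.
  by apply/tau_set_switch; rewrite tau_set_merge.
move=> f; rewrite !in_switch !inE; case: (eqVneq f (val e)) => [->|neqf].
  rewrite (negbTE (mem_lift_contracted D)) merge_end1 merge_end2 eqxx.
  rewrite (eq_sym y) (negbTE (valP e)) !andbF addbF andbT.
  by case: (_ \in X'); case: (s && _).
rewrite -[f in f \in _]/(val (Sub f neqf : edge J)) mem_lift defD /= inE SubK.
rewrite in_contract_Sigma -/(merge _) -/(merge _).
case: s {tauX' defD}; case: (val e \in _); case: (f \in _);
  case: (merge _ \in X'); case: (merge _ \in X'); case: (_ == x); case: (_ == x) => //.
Qed.

(** Because [e] is not in [C], the switched set [Y] contains both ends of [e] or neither, so it is a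
    union of fibres of [merge] and descends to [X']. *)
Lemma even_cut_avoiding C : even_cut C -> val e \notin C ->
  even_cut ([set f | val f \in C] : {set edge J}).
Proof.
move/even_cutP=> [s [X [tauX defC]]] eC; apply/even_cutP.
pose Y := switch s X.
have xyY : (x \in Y) = (y \in Y).
  move: eC; rewrite defC !in_switch eqxx (eq_sym y) (negbTE (valP e)) !andbF.
  by case: (_ \in X); case: (_ \in X); case: s {tauX defC Y}; case: (_ \in _).
pose X' : {set vertex J} :=
  [set w | if w is Some v then val v \in Y else x \in Y].
have mergeX' v : (merge v \in X') = (v \in Y).
  rewrite inE; case: (eqVneq v x) => [->|vx]; first by rewrite merge_end1.
  case: (eqVneq v y) => [->|vy]; first by rewrite merge_end2.
  have v_in : (v != x) && (v != y) by rewrite vx.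
  by rewrite -[v]/(val (Sub v v_in : {v | (v != x) && (v != y)})) merge_val.
exists s, X'; split=> [|f].
  rewrite -tau_set_merge (_ : [set v | _] = Y); last first.
    by apply/setP=> v; rewrite inE mergeX'.
  (* Switching twice restores [X]. *)
  apply/tau_set_switch; rewrite -tauX; congr tau_set; apply/setP=> v.
  by rewrite !in_switch -addbA addbb addbF.
rewrite inE defC /= inE in_contract_Sigma.
rewrite -![insub _]/(merge _) !mergeX' !in_switch.
case: s {tauX defC Y xyY X' mergeX'}; case: (val e \in _); case: (val f \in _);
  case: (_ \in X); case: (_ \in X); case: (_ == x); case: (_ == x) => //.
Qed.

(** Lifting preserves size and non-emptiness, so the contraction has no even cut below [k], and [C]
    itself descends to one of size [k]. *)
Lemma contract_avoiding_optimal C k : optimal_value I k ->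
  even_cut C -> C != set0 -> #|C| = k -> val e \notin C -> optimal_value J k.
Proof.
move=> [_ min] evC C0 cardC eC.
have liftC : lift [set f | val f \in C] = C.
  apply/setP=> f; apply/imsetP/idP => [[g /[!inE] gC -> //]|fC].
  have fe : f != val e by apply: contraNneq eC => <-.
  by exists (Sub f fe); rewrite ?inE.
split=> [|D evD D0].
  exists [set f | val f \in C]; split; first exact: even_cut_avoiding.
    by rewrite -card_gt0 -card_lift liftC card_gt0.
  by rewrite -card_lift liftC.
rewrite -card_lift; apply: min; first exact: even_cut_lift.
by rewrite -card_gt0 card_lift card_gt0.
Qed.

(** Paths are mapped by [merge]; a step along [e] becomes stationary. *)
Lemma contract_connected : connected_graph I -> connected_graph J.
Proof.
move=> conn.
have merge_surj (w : vertex J) : exists v, merge v = w.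
  case: w => [v|]; [by exists (val v); exact: merge_val|by exists x; exact: merge_end1].
move=> w w'; have [u <-] := merge_surj w; have [u' <-] := merge_surj w'.
have {w w'} /connectP[p] := conn u u'.
elim: p u => [|v p IHp] u /=; first by move=> _ ->; exact: connect0.
case/andP=> uv /IHp{}IHp /IHp; apply: connect_trans.
case/existsP: uv => f; case: (eqVneq f (val e)) => [-> uv|fe uv].
  have : ((u == x) && (v == y)) || ((u == y) && (v == x)).
    by case/orP: uv => /eqP ->; rewrite !eqxx ?orbT.
  case/orP=> /andP[/eqP-> /eqP->]; rewrite merge_end1 merge_end2; exact: connect0.
apply/connect1/existsP; exists (Sub f fe : edge J) => /=.
by case/orP: uv => /eqP ->; rewrite /= -!/(merge _) eqxx ?orbT.
Qed.

Lemma returns_lift k (D : option {set edge J}) :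
  returns_cocycle_of_size k D -> returns_cocycle_of_size k (lift_result D).
Proof.
case: D => [D|] //; rewrite /returns_cocycle_of_size => /andP[/cocycleP evD cardD].
by apply/andP; split; [apply/cocycleP/even_cut_lift | rewrite card_lift].
Qed.

End EdgeContraction.

(** * Vertex degrees and the number of non-loop edges *)

Section Degrees.
Variable G : graph.
Implicit Types X Y : {set vertex G}.

Lemma cut_symdiff X Y : cut (symdiff X Y) = symdiff (cut X) (cut Y).
Proof.
apply/setP=> e; rewrite in_symdiff ![_ \in cut _]inE !in_symdiff.
by do 4!case: (_ \in _).
Qed.

(** If no edge leaves [X], then [X] is closed under adjacency, and connectedness spreads it over all
    vertices. *)
Lemma cut_neq0 X : connected_graph G -> X != set0 -> X != setT -> cut X != set0.
Proof.
move=> conn /set0Pn[u uX]; apply: contra_neq => cut0; apply/setP=> v.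
have closedX : closed (@adjacent G) (mem X).
  move=> a b /existsP[e ab]; have := in_set0 e; rewrite -cut0 inE.
  by case/orP: ab => /eqP -> /=; do 2!case: (_ \in X).
by have /= := closed_connect closedX (conn u v); rewrite uX inE => <-.
Qed.

(** Double counting: a non-loop edge lies in the cuts of its two ends, a loop in none. *)
Lemma sum_card_cut1 : \sum_(v : vertex G) #|cut [set v]| = 2 * #|nonloop_edge G|.
Proof.
under eq_bigr => v _ do rewrite -sum1_card big_mkcond.
rewrite exchange_big /= card_sig -sum1_card big_distrr [RHS]big_mkcond /=.
apply: eq_bigr => e _; rewrite inE; under eq_bigr => v _ do rewrite !inE.
case: eqVneq => [->|ne] /=; first by rewrite big1 // => v _; rewrite addbb.
rewrite -big_mkcond sum1_card (_ : 2 * 1 = #|[set (ends e).1; (ends e).2]|).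
  apply: eq_card => v; rewrite !inE [LHS]unfold_in !(eq_sym v).
  by case: (eqVneq (ends e).1 v) => [<-|_] //=; rewrite eq_sym (negbTE ne).
by rewrite cards2 ne.
Qed.

End Degrees.

Lemma cut_even_cut t (I : instance t) (X : {set vertex I}) :
  tau_set X = 0%R -> even_cut (cut X).
Proof.
move=> tauX; exists set0, 0%R, X; split=> //; first by right.
by apply/setP=> e; rewrite in_symdiff in_set0 addbF.
Qed.

(* Two vertices of the same [tau] and degrees summing to less than [k] would give
   an even cut that is too small, so at most [2 ^ t] vertices have degree less
   than [k / 2]. *)
Lemma optimal_value_degree t (I : instance t) k :
    connected_graph I -> 2 < #|vertex I| -> optimal_value I k ->
  k * (#|vertex I| - 2 ^ t) <= 4 * #|nonloop_edge I|.
Proof.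
move=> conn gt2 [_ min]; pose d v := #|cut [set v : vertex I]|.
pose S := [set v | 2 * d v < k].
have cardS : #|S| <= 2 ^ t.
  have <- : #|{: 'rV['F_2]_t}| = 2 ^ t by rewrite card_mx card_Fp // mul1n.
  apply: (@leq_card_in _ _ (@tau t I)) => u v; rewrite !inE => du dv tauE.
  apply/eqP/negPn/negP=> neq; pose X := symdiff [set u] [set v].
  have XE : X = [set u; v].
    apply/setP=> w; rewrite in_symdiff !inE; case: (eqVneq w u) => //= ->.
    by rewrite neq.
  have /min : even_cut (cut X).
    apply: cut_even_cut.
    by rewrite tau_set_symdiff /tau_set !big_set1 tauE addrr_F2.
  rewrite cut_neq0 // ?XE; last 2 first.
  - by apply/set0Pn; exists u; rewrite !inE eqxx.
  (* A third vertex keeps [[set u; v]] from being everything, so its cut is non-empty. *)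
  - by apply: contraTneq gt2 => XT; rewrite -cardsT -XT cards2 neq.
  move/(_ isT); rewrite -XE cut_symdiff.
  by have := card_symdiff_le (cut [set u]) (cut [set v]); rewrite -/(d u) -/(d v); lia.
have -> : 4 * #|nonloop_edge I| = \sum_v 2 * d v.
  by rewrite -big_distrr sum_card_cut1; exact: esym (mulnA 2 2 _).
(* At least [#|vertex I| - 2 ^ t] vertices lie outside [S], and each contributes at least [k] to the
   sum. *)
apply: (@leq_trans (\sum_(v in ~: S) k)).
  by rewrite sum_nat_const cardsCs setCK mulnC leq_mul2r leq_sub2l ?orbT.
rewrite big_mkcond leq_sum // => v _; rewrite !inE.
by case: ltnP.
Qed.

(** * Probabilities of events in finite distributions *)

Section Probability.
Variable R : realType.
Local Open Scope ring_scope.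

Lemma eq_prob (A : finType) (p q : fdist R A) (S : {set A}) :
  p =1 q -> prob p S = prob q S.
Proof. by move=> pq; apply: eq_bigr. Qed.

Lemma prob_dirac (A : finType) (a : A) (S : {set A}) :
  prob (fdist_dirac R a) S = (a \in S)%:R.
Proof.
rewrite /prob /= /dirac_pmf; case: (boolP (a \in S)) => aS.
  by rewrite (bigD1 a) //= eqxx big1 ?addr0 // => b /andP[_ /negPf ->].
by rewrite big1 // => b bS; case: eqVneq => // ba; rewrite -ba bS in aS.
Qed.

Lemma prob_bind (A B : finType) (p : fdist R A) (q : A -> fdist R B) S :
  prob (fdist_bind p q) S = \sum_a p a * prob (q a) S.
Proof.
rewrite /prob /= /bind_pmf exchange_big /=.
by apply: eq_bigr => a _; rewrite mulr_sumr.
Qed.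

Lemma prob_map (A B : finType) (f : A -> B) (p : fdist R A) S :
  prob (fdist_map f p) S = prob p (f @^-1: S).
Proof.
rewrite prob_bind [RHS]big_mkcond; apply: eq_bigr => a _.
by rewrite prob_dirac inE; case: (_ \in S); rewrite ?mulr1 ?mulr0.
Qed.

Lemma prob_ge0 (A : finType) (p : fdist R A) S : 0 <= prob p S.
Proof. by apply: sumr_ge0 => a _; exact: pmf_ge0. Qed.

Lemma prob_mono (A : finType) (p : fdist R A) (S S' : {set A}) :
  S \subset S' -> prob p S <= prob p S'.
Proof.
move=> sSS'; rewrite /prob [leRHS](big_setID S) /= (setIidPr sSS') lerDl.
exact: (prob_ge0 p (S' :\: S)).
Qed.

Lemma prob_setC (A : finType) (p : fdist R A) S : prob p (~: S) = 1 - prob p S.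
Proof.
rewrite -(pmf_sum1 p) (bigID (mem S)) /= addrC addrK.
by apply: eq_bigl => a; rewrite inE.
Qed.

(** The event is a product set, so its probability is the expansion of a power of a sum. *)
Lemma prob_iid_all N (A : finType) (p : fdist R A) (Q : pred A) :
  prob (fdist_iid N p) [set w : {ffun 'I_N -> A} | [forall i, Q (w i)]]
    = prob p [set a | Q a] ^+ N.
Proof.
rewrite -[in RHS](card_ord N) -prodr_const /prob.
rewrite (bigA_distr_big _ (fun _ a => p a)) /=; apply: eq_bigl => w.
by rewrite inE; apply: eq_forallb => i; rewrite inE.
Qed.

End Probability.

(** * Success probability of one run *)

Section RandomContraction.
Variables (R : realType) (t : nat).
Variable search : forall I : instance t, option {set edge I}.
Hypothesis search_spec : exhaustive_search search.

Definition success_prob (I : instance t) (k : nat) : R :=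
  prob (random_contraction R search I) [set C | returns_cocycle_of_size k C].

Lemma success_prob_search (I : instance t) k :
  #|vertex I| <= 2 ^ t + 4 -> optimal_value I k -> success_prob I k = 1%R.
Proof.
move=> small opt; rewrite /success_prob (eq_prob _ (@random_contractionE R t search I)).
rewrite small prob_dirac inE; have := search_spec I.
case: (search I) => [C minC | no_cocycle].
  rewrite /returns_cocycle_of_size (minimum_nonempty_cocycle_size opt minC) eqxx.
  by case: minC => ->.
have [[C [evC C0 _]] _] := opt.
by rewrite (no_cocycle C) ?eqxx // in C0; apply/cocycleP.
Qed.

(** Condition on the first contracted edge: an edge avoiding [C] contributes at least [B], any other
    at least 0. Multiplying by the number of edges clears the uniform weight. *)
Lemma success_prob_contract (I : instance t) k (B : R) (C : {set edge I}) :
    2 ^ t + 4 < #|vertex I| -> 0 < #|nonloop_edge I| ->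
    (forall e : nonloop_edge I, val e \notin C ->
       B <= success_prob (contract_edge e) k)%R ->
  (#|[set e : nonloop_edge I | val e \notin C]|%:R * B
     <= #|nonloop_edge I|%:R * success_prob I k)%R.
Proof.
move=> big m_gt0 leB.
rewrite /success_prob (eq_prob _ (@random_contractionE R t search I)).
rewrite leqNgt big /=; case: pickP => [e0 _|no_edge]; last first.
  by rewrite eq_card0 in m_gt0.
rewrite prob_bind -mulr_sumr /= /uniform_pmf mulVKf ?pnatr_eq0 -?lt0n //.
rewrite mulr_natl -sumr_const [leLHS]big_mkcond /=; apply: ler_sum => e _.
rewrite prob_map inE; case: ifP => eC; last exact: prob_ge0.
apply: le_trans (leB e eC) (prob_mono _ _); apply/subsetP=> D; rewrite !inE.
exact: returns_lift.
Qed.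

Lemma card_nonloop_edge_avoiding (I : instance t) (C : {set edge I}) :
  #|nonloop_edge I| - #|C| <= #|[set e : nonloop_edge I | val e \notin C]|.
Proof.
rewrite leq_subLR -(cardsC [set e : nonloop_edge I | val e \in C]) leq_add //.
  rewrite -(card_imset _ val_inj) subset_leq_card //.
  by apply/subsetP=> f /imsetP[e /[!inE] eC ->].
by rewrite subset_leq_card //; apply/subsetP=> e; rewrite !inE.
Qed.

(** Exhaustive search starts exactly when [#|vertex I| - 2 ^ t] is at most 4, where [maxn] makes the
    binomial equal to 1. Above that, contracting an edge outside one fixed optimal cut keeps [k],
    and the induction hypothesis applies with [N.-1]. *)
Lemma success_prob_bin (I : instance t) k :
    connected_graph I -> optimal_value I k ->
  (1 <= 'C(maxn 4 (#|vertex I| - 2 ^ t), 4)%:R * success_prob I k)%R.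
Proof.
have [n] := ubnP #|vertex I|; elim: n I => // n IHn I ltVn conn opt.
have [small|large] := leqP #|vertex I| (2 ^ t + 4).
  by rewrite success_prob_search // mulr1 ler1n bin_gt0 leq_maxl.
have [[C [evC C0 cardC]] _] := opt.
have deg : k * (#|vertex I| - 2 ^ t) <= 4 * #|nonloop_edge I|.
  by apply: optimal_value_degree => //; lia.
set N := (#|vertex I| - 2 ^ t) in deg *; set m := #|nonloop_edge I| in deg *.
have N_gt4 : 4 < N by rewrite /N; lia.
have k_gt0 : 0 < k by rewrite -cardC card_gt0.
(* The degree bound itself supplies a non-loop edge to contract. *)
have m_gt0 : 0 < m by nia.
pose B := 'C(N.-1, 4); have B_gt0 : 0 < B by rewrite bin_gt0; lia.
have leB (e : nonloop_edge I) : val e \notin C ->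
    (B%:R^-1 <= success_prob (contract_edge e) k)%R.
  move=> eC; have cardI := card_contract_edge e.
  have optJ := contract_avoiding_optimal opt evC C0 cardC eC.
  have := IHn (contract_edge e) _ (contract_connected conn) optJ.
  rewrite -[X in X < n]/(#|vertex (contract_edge e)|) -ltnS -cardI => /(_ ltVn).
  have -> : maxn 4 (#|vertex (contract_edge e)| - 2 ^ t) = N.-1.
    by rewrite /N cardI; lia.
  by rewrite mulrC -ler_pdivrMr ?ltr0n // div1r.
have := success_prob_contract large m_gt0 leB; rewrite -/m.
set q := #|_| => le_q.
have qE : m * B <= 'C(N, 4) * q.
  have := card_nonloop_edge_avoiding C; rewrite -/m -/q cardC => mkq.
  have down := mul_bin_down N 4; rewrite -/B in down.
  rewrite -(@leq_pmul2l N); last by lia.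
  (* From [q >= m - k] and [k * N <= 4 * m]. With [down], this factor turns ['C(N.-1, 4)] into
     ['C(N, 4)]. *)
  have mq : m * (N - 4) <= N * q by nia.
  by rewrite mulnCA down mulnA (mulnC _ q) [leqRHS]mulnA leq_mul2r mq orbT.
have -> : maxn 4 N = N by lia.
rewrite -(@ler_pM2l _ m%:R) ?ltr0n // mulr1 mulrCA.
apply: le_trans (ler_wpM2l (ler0n _ _) le_q).
by rewrite mulrA ler_pdivlMr ?ltr0n // -!natrM ler_nat.
Qed.

(** As 24 is the factorial of 4, [24 * 'C(N, 4)] is a falling factorial of four factors, each at
    most [#|vertex I|]. *)
Lemma success_prob_large (I : instance t) k :
    2 ^ t + 4 < #|vertex I| -> connected_graph I -> optimal_value I k ->
  (24%:R <= (#|vertex I| ^ 4)%:R * success_prob I k)%R.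
Proof.
move=> large conn opt; have := success_prob_bin conn opt.
set N := maxn 4 _ => leN.
have le_pow : 24 * 'C(N, 4) <= #|vertex I| ^ 4.
  have leNV : N <= #|vertex I| by rewrite /N; lia.
  rewrite mulnC (bin_ffact N 4) !ffactnS ffactn0 muln1 !expnS muln1.
  by rewrite !leq_mul //; lia.
apply: (@le_trans _ _ ((24 * 'C(N, 4))%:R * success_prob I k)%R).
  by rewrite natrM -mulrA ler_peMr.
by rewrite ler_wpM2r ?prob_ge0 // ler_nat.
Qed.

End RandomContraction.

(** * Independent runs *)

Theorem theorem3p8 (R : realType) (t c : nat) (t_gt0 : 0 < t) (c_gt0 : 0 < c)
    (search : forall I : instance t, option {set edge I})
    (search_spec : exhaustive_search search)
    (I : instance t) (I_feasible : feasible I) (I_connected : connected_graph I)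
    (k : nat) (k_opt : optimal_value I k) :
  (prob (fdist_iid (c * #|vertex I| ^ 4) (random_contraction R search I))
        [set w : {ffun 'I_(c * #|vertex I| ^ 4) -> option {set edge I}} |
          [forall i, ~~ returns_cocycle_of_size k (w i)]]
     <= expR (- (24 * c)%:R))%R.
Proof.
rewrite (prob_iid_all _ _ (fun C => ~~ returns_cocycle_of_size k C)).
rewrite (_ : [set a | _] = ~: [set a | returns_cocycle_of_size k a]); last first.
  by apply/setP=> C; rewrite !inE.
rewrite prob_setC -/(success_prob R search I k).
have [small|large] := leqP #|vertex I| (2 ^ t + 4).
  (* A run fails with probability 0, but the power of 0 vanishes only if there is at least one run.
     Feasibility gives an edge, hence a vertex. *)
  rewrite success_prob_search // subrr expr0n muln_eq0 expn_eq0 /= andbT.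
  have V_gt0 : 0 < #|vertex I|.
    have [C [_ /set0Pn[e _]]] := I_feasible.
    by apply/card_gt0P; exists (ends e).1.
  by rewrite !eqn0Ngt c_gt0 V_gt0 expR_ge0.
have p_ge := success_prob_large R search_spec large I_connected k_opt.
set p := success_prob R search I k in p_ge *.
have p_le1 : (0 <= 1 - p)%R by rewrite /p /success_prob -prob_setC prob_ge0.
apply: (@le_trans _ _ (expR (- p) ^+ (c * #|vertex I| ^ 4))%R).
  by rewrite lerXn2r ?nnegrE ?expR_ge0 // expR_ge1Dx.
(* What remains is [c] times the bound [p_ge]. *)
rewrite -expRM_natl ler_expR mulrN lerN2 mulnC natrM (natrM _ c) -mulrA.
by rewrite ler_wpM2l.
Qed.
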